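(* Let $X$ be a normed real vector space, let $p\ge 1$ and let $\theta=(k_r)$ be a lacunary sequence. Then the following are equivalent: (1) $X$ is complete. (2) $S_{N_\theta}(\sum_i x_i)$ is a complete space for every weakly unconditionally Cauchy series (wuC) $\sum_i x_i$ in $X$. (3) $S_{S_\theta}(\sum_i x_i)$ is a complete space for every weakly unconditionally Cauchy series (wuC) $\sum_i x_i$ in $X$. (4) $S_{w_p}(\sum_i x_i)$ is a complete space for every weakly unconditionally Cauchy series (wuC) $\sum_i x_i$ in $X$.
   Context: A lacunary sequence is a (strictly) increasing sequence $\theta=(k_r)_{r\ge 0}$ of natural numbers with $k_0=0$ and $h_r=k_r-k_{r-1}\to+\infty$ as $r\to\infty$. For $r\ge 1$ put $I_r=(k_{r-1},k_r]$ (the set of integers $k$ with $k_{r-1}<k\le k_r$). Let $(s_k)$ be a sequence in the normed space $X$ and $L\in X$. - $(s_k)$ is $N_\theta$-summable (lacunary strongly convergent) to $L$ if $\lim_{r\to\infty}\frac{1}{h_r}\sum_{k\in I_r}\|s_k-L\|=0$. - $(s_k)$ is $S_\theta$-convergent (lacunary statistically convergent) to $L$ if for every $\varepsilon>0$, $\lim_{r\to\infty}\frac{1}{h_r}\mathrm{card}(\{k\in I_r:\|s_k-L\|\ge\varepsilon\})=0$. - $(s_k)$ is strongly $p$-Cesàro summable, or $w_p$-summable, to $L$ if $\lim_{n\to\infty}\frac1n\sum_{k=1}^n\|s_k-L\|^p=0$. A series $\sum_i z_i$ in $X$ is $N_\theta$-summable (respectively $S_\theta$-summable, $w_p$-summable)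 if its sequence of partial sums $s_k=\sum_{i=1}^k z_i$ is $N_\theta$-summable (respectively $S_\theta$-convergent, $w_p$-summable) to some $L\in X$. $\ell_\infty$ is the space of bounded real sequences. For a series $\sum_i x_i$ in $X$, define $$S_{N_\theta}\Big(\sum_i x_i\Big)=\Big\{(a_i)_i\in\ell_\infty:\ \sum_i a_i x_i \text{ is } N_\theta\text{-summable}\Big\},$$ $$S_{S_\theta}\Big(\sum_i x_i\Big)=\Big\{(a_i)_i\in\ell_\infty:\ \sum_i a_i x_i \text{ is } S_\theta\text{-summable}\Big\},$$ $$S_{w_p}\Big(\sum_i x_i\Big)=\Big\{(a_i)_i\in\ell_\infty:\ \sum_i a_i x_i \text{ is } w_p\text{-summable}\Big\},$$ each endowed with the supremum norm. A series $\sum_i x_i$ in $X$ is weakly unconditionally Cauchy (wuC) if for every permutation $\pi$ of $\mathbb{N}$ the sequence $(\sum_{i=1}^n x_{\pi(i)})_n$ is weakly Cauchy; equivalently, $\sum_i|f(x_i)|<\infty$ for every $f\in X^*$. *)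

(* Defs.v *)
From HB Require Import structures.
From mathcomp Require Export all_boot all_order all_algebra.
From mathcomp Require Export all_classical all_reals all_analysis.
Set Implicit Arguments.
Unset Strict Implicit.
Unset Printing Implicit Defensive.
Import Order.TTheory GRing.Theory Num.Theory.
Export numFieldNormedType.Exports.
Local Open Scope classical_set_scope.
Local Open Scope ring_scope.

(** Completeness of a subset for the induced uniformity; for [A = setT] this is
    the library's [cauchy_cvg], see [complete_setT]. *)

Definition complete_set (T : uniformType) (A : set T) : Prop :=
  forall F : set_system T, ProperFilter F -> F A -> cauchy F ->
    exists2 x, A x & F --> x.

Lemma complete_setT (T : puniformType) :
  complete_set [set: T] <->
  (forall F : set_system T, ProperFilter F -> cauchy F -> cvg F).
Proof.
split=> cT F FF.
  by move=> Fc; have [x _ Fx] := cT F FF filterT Fc; apply/cvg_ex; exists x.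
by move=> _ /(cT F FF) Fx; exists (lim F).
Qed.

(** The space of bounded real sequences with the supremum norm. *)

Section linf.
Context (R : realType).

Lemma bounded_seqP (a : nat -> R) :
  bounded_fun a <-> exists M, forall i, `|a i| <= M.
Proof.
have bP := @ex_bound nat R R a _ (globally_properfilter (I : [set: nat] 0%N)).
apply: (iff_trans bP); by split=> -[M aM]; exists M => i; [exact: aM|move=> _; exact: aM].
Qed.

Definition linf_pred : {pred nat -> R} :=
  mem [set a : nat -> R | bounded_fun a].

Record linf := Linf { linf_val :> nat -> R ; linf_valP : linf_val \in linf_pred }.

HB.instance Definition _ := [isSub for linf_val].
HB.instance Definition _ := [Choice of linf by <:].

Lemma linf_submod_closed : submod_closed linf_pred.
Proof.
split=> [|c a b].
  apply/mem_set/bounded_seqP; exists 0 => i.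
  by rewrite normr0.
move=> /set_mem/bounded_seqP[M aM] /set_mem/bounded_seqP[N bN].
apply/mem_set/bounded_seqP; exists (`|c| * M + N) => i.
by rewrite (le_trans (ler_normD _ _))// lerD// normrM ler_wpM2l.
Qed.

HB.instance Definition _ :=
  GRing.isSubmodClosed.Build _ _ linf_pred linf_submod_closed.
HB.instance Definition _ := [SubChoice_isSubLmodule of linf by <:].

Definition linf_norm (a : linf) : R := sup (range (fun i => `|a i|)).

Lemma linf_has_ubound (a : linf) : has_ubound (range (fun i => `|a i|)).
Proof.
have /set_mem/bounded_seqP[M aM] := linf_valP a.
by exists M => _ [i _ <-]; exact: aM.
Qed.

Lemma le_linf_norm (a : linf) i : `|a i| <= linf_norm a.
Proof. by apply: ub_le_sup; [exact: linf_has_ubound|exists i]. Qed.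

Lemma linf_norm_le (a : linf) M : (forall i, `|a i| <= M) -> linf_norm a <= M.
Proof. by move=> aM; apply: ge_sup; [exists `|a 0%N|, 0%N|move=> _ [i _ <-]]. Qed.

Lemma linf_normD (a b : linf) : linf_norm (a + b) <= linf_norm a + linf_norm b.
Proof.
apply: linf_norm_le => i.
by rewrite (le_trans (ler_normD _ _))// lerD// le_linf_norm.
Qed.

Lemma linf_normZ (c : R) (a : linf) : linf_norm (c *: a) = `|c| * linf_norm a.
Proof.
have le d b : linf_norm (d *: b) <= `|d| * linf_norm b.
  by apply: linf_norm_le => i; rewrite /= normrM ler_wpM2l// le_linf_norm.
apply/eqP; rewrite eq_le le/=.
have [->|c0] := eqVneq c 0.
  by rewrite normr0 mul0r (le_trans (normr_ge0 _) (le_linf_norm _ 0%N)).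
rewrite mulrC -ler_pdivlMr ?normr_gt0// mulrC -normfV.
by rewrite -[X in linf_norm X <= _](scalerK c0) le.
Qed.

Lemma linf_norm_eq0 (a : linf) : linf_norm a = 0 -> a = 0.
Proof.
move=> a0; apply/val_inj/funext => i; apply/eqP.
by rewrite -normr_le0 -a0 le_linf_norm.
Qed.

HB.instance Definition _ :=
  Lmodule_isNormed.Build R linf linf_normD linf_normZ linf_norm_eq0.

End linf.

(** Lacunary sequences: [theta r] is k_r, [lac_h theta r] is h_r and
    [lac_I theta r] enumerates I_r = (k_(r-1), k_r]; the latter two are only
    meaningful for [r >= 1], which does not affect limits as r -> oo. *)

Definition lac_h (theta : nat -> nat) (r : nat) : nat :=
  (theta r - theta r.-1)%N.

Definition lac_I (theta : nat -> nat) (r : nat) : seq nat :=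
  index_iota (theta r.-1).+1 (theta r).+1.

Definition lacunary (theta : nat -> nat) : Prop :=
  [/\ theta 0%N = 0%N,
      {homo theta : m n / (m < n)%N} &
      lac_h theta @ \oo --> \oo].

(** Convergence notions for sequences (s_k) indexed by [k >= 1]: the value
    [s 0] is never used. *)

Section convergence.
Context (R : realType) (X : normedModType R).
Implicit Types (s : nat -> X) (L : X).

Definition Ntheta_cvg (theta : nat -> nat) s L : Prop :=
  (lac_h theta r)%:R^-1 * (\sum_(k <- lac_I theta r) `|s k - L|)
    @[r --> \oo] --> (0 : R).

Definition Stheta_cvg (theta : nat -> nat) s L : Prop :=
  forall e : R, 0 < e ->
    (lac_h theta r)%:R^-1 * (count (fun k => e <= `|s k - L|) (lac_I theta r))%:R
      @[r --> \oo] --> (0 : R).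

Definition wp_cvg (p : R) s L : Prop :=
  n%:R^-1 * (\sum_(1 <= k < n.+1) `|s k - L| `^ p) @[n --> \oo] --> (0 : R).

(** Series are indexed from 0, so the i-th term z_i (i >= 1) is [z i.-1], and
    [series z k] is the sum of the first [k] terms. *)

Definition S_set (C : (nat -> X) -> X -> Prop) (x : nat -> X) : set (linf R) :=
  [set a : linf R | exists L, C (series (fun i => a i *: x i)) L].

Definition S_Ntheta (theta : nat -> nat) := S_set (Ntheta_cvg theta).
Definition S_Stheta (theta : nat -> nat) := S_set (Stheta_cvg theta).
Definition S_wp (p : R) := S_set (wp_cvg p).

Definition weakly_cauchy s : Prop :=
  forall f : {linear X -> R^o}, continuous f -> cauchy (f \o s @ \oo).

Definition wuC (x : nat -> X) : Prop :=
  forall pi : nat -> nat, bijective pi -> weakly_cauchy (series (x \o pi)).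

End convergence.

(* Main.v *)
From HB Require Import structures.
Require Import Defs.
From mathcomp Require Import lra.
Set Implicit Arguments.
Unset Strict Implicit.
Unset Printing Implicit Defensive.
Import Order.TTheory GRing.Theory Num.Theory.
Local Open Scope classical_set_scope.
Local Open Scope ring_scope.

(** For a wuC series [x] and a bounded sequence [a], the partial sums of
    [a_i x_i] are bounded by a multiple of the norm of [a]: rearrangement
    invariance makes each [f (x_i)] absolutely summable, and weakly bounded sets
    are norm bounded (Hahn-Banach and a gliding hump). On bounded sequences the
    three summability notions all reduce to convergence in density along finite
    index sets [J r] whose sizes tend to infinity.

    If X is complete and [a^n -> a] with [a^n] in the summability space, the
    density limits [L_n] of the series of [a^n] form a Cauchy sequence, because
    the partial sums depend on [a] in a Lipschitz way, and their limit is the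
    density limit for [a]. Conversely, let [u] be a Cauchy sequence with
    increments at most [4^-n]. Then [x_i = 2^i (u_(i+1) - u_i)] is wuC and the
    truncations of [a_i = 2^-i] lie in the summability space, so by completeness
    [a] does too, and the density limit of [u_k - u_0] yields the limit of [u]. *)

(** * Hahn-Banach and uniform boundedness *)

Section hahn_banach.
Context (R : realType) (X : normedModType R).
Implicit Types (G : set (X * R^o)) (v : X).

(* The graph of a partial linear functional dominated by the norm: domination
   forces it to be single-valued, and the empty graph is allowed so that Zorn's
   lemma applies to the empty chain. *)
Definition dominated_graph G : Prop :=
  (forall (c : R) p q, G p -> G q -> G (c *: p + q)) /\
  (forall p, G p -> p.2 <= `|p.1|).

(** A value at [v] is admissible once it lies between all [p.2 - |p.1 - v|] and all
    [|p.1 + v| - p.2]. The triangle inequality puts every lower bound below every upper one, so the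
    supremum of the lower ones works; scaling by [|t|] reduces other multiples of [v] to these
    cases. *)
Lemma dominated_graph_extend G v : G !=set0 -> dominated_graph G ->
  exists (c : R), dominated_graph
    [set p | exists q (t : R), G q /\ p = q + t *: ((v, c) : X * R^o)].
Proof.
move=> [q0 Gq0] [Glin Gdom].
have G0 : G 0 by have := Glin (-1) _ _ Gq0 Gq0; rewrite scaleN1r addNr.
have GZ (t : R) q : G q -> G (t *: q) by move=> Gq; rewrite -[_ *: _]addr0; exact: Glin.
pose A := [set p.2 - `|p.1 - v| | p in G].
have A0 : A !=set0 by exists (q0.2 - `|q0.1 - v|), q0.
have Aub p : G p -> ubound A (`|p.1 + v| - p.2).
  move=> Gp _ [q Gq <-]; rewrite lerBrDr addrAC lerBlDr.
  have := Gdom _ (Glin 1 _ _ Gp Gq); rewrite scale1r/= addrC => /le_trans; apply.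
  rewrite (le_trans _ (ler_normD _ _))//.
  by rewrite addrACA subrr addr0.
have hA : has_sup A by split => //; exists (`|q0.1 + v| - q0.2); exact: Aub.
exists (sup A); split.
  move=> c _ _ [p [s [Gp ->]]] [q [t [Gq ->]]].
  exists (c *: p + q), (c * s + t); split; first exact: Glin.
  by rewrite scalerDr scalerA scalerDl addrACA.
move=> _ [p [t [Gp ->]]] /=.
have [t0|t0|->] := ltgtP t 0; last by rewrite !scale0r !addr0; exact: Gdom.
- have s0 : 0 < - t by rewrite oppr_gt0.
  have : ((- t)^-1 *: p).2 - `|((- t)^-1 *: p).1 - v| <= sup A.
    by apply: ub_le_sup; [exact: hA.2|exists ((- t)^-1 *: p) => //; exact: GZ].
  have -> : ((- t)^-1 *: p).1 - v = (- t)^-1 *: (p.1 + t *: v).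
    by rewrite scalerDr scalerA invrN mulNr mulVf ?scaleN1r// lt_eqF.
  rewrite normrZ gtr0_norm ?invr_gt0//= -mulrBr ler_pdivrMl//.
  by rewrite mulNr lerBlDl -lerBlDr opprK.
- have : sup A <= `|(t^-1 *: p).1 + v| - (t^-1 *: p).2.
    by apply: ge_sup => //; apply: Aub; exact: GZ.
  have -> : (t^-1 *: p).1 + v = t^-1 *: (p.1 + t *: v).
    by rewrite scalerDr scalerA mulVf ?scale1r// gt_eqF.
  rewrite normrZ gtr0_norm ?invr_gt0//= -mulrBr ler_pdivlMl//.
  by rewrite lerBrDl.
Qed.

(** Zorn's lemma over dominated graphs that are empty or contain [(v, |v|)]. A maximal one is
    nonempty, since the line through [(v, |v|)] is dominated, and total, since otherwise the
    extension would enlarge it. *)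
Lemma dominated_graph_total v : exists G,
  [/\ dominated_graph G, G (v, `|v|) & forall x, exists r, G (x, r)].
Proof.
pose P := [set G | dominated_graph G /\ (G = set0 \/ G (v, `|v|))].
have [|G [[dG G0] Gmax]] := @Zorn_bigcup _ P.
  move=> F FP tF; split; first split.
  - move=> c p q [Y FY Yp] [Z FZ Zq].
    have [YZ|ZY] := tF _ _ FY FZ; [exists Z|exists Y] => //.
    + by have [[+ _] _] := FP _ FZ; apply => //; exact: YZ.
    + by have [[+ _] _] := FP _ FY; apply => //; exact: ZY.
  - by move=> p [Y FY Yp]; have [[_ +] _] := FP _ FY; apply.
  - have [[Y FY Y0]|F0] := pselect (exists2 Y, F Y & Y !=set0).
      right; exists Y => //; have [_ [Ye|//]] := FP _ FY.
      by move: Y0; rewrite Ye => -[].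
    left; apply/seteqP; split => // p [Y FY Yp]; apply: F0.
    by exists Y => //; exists p.
have Gv : G (v, `|v|).
  case: G0 => // G0; exfalso.
  apply: (Gmax [set p | exists t : R, p = t *: ((v, `|v|) : X * R^o)]).
    rewrite G0; split; first by move=> ? [].
    by move=> /(_ (v, `|v|)); apply; exists 1; rewrite scale1r.
  split; last by right; exists 1; rewrite scale1r.
  split; first by move=> c _ _ [s ->] [t ->]; exists (c * s + t); rewrite scalerDl scalerA.
  by move=> _ [t ->] /=; rewrite normrZ ler_wpM2r// ler_norm.
exists G; split => // x.
have Gn0 : G !=set0 by exists (v, `|v|).
have [c dG'] := dominated_graph_extend x Gn0 dG.
set G' := (X in dominated_graph X) in dG'.
have GG' : G `<=` G' by move=> q Gq; exists q, 0; rewrite scale0r addr0.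
exists c; apply: contrapT => nGx; apply: (Gmax G'); last by split=> //; right; exact: GG'.
split=> // G'G; apply/nGx/G'G; exists 0, 1; rewrite scale1r add0r; split => //.
by have := dG.1 (-1) _ _ Gv Gv; rewrite scaleN1r addNr.
Qed.

(** Domination at a difference of two graph points over the same vector forces equal values;
    domination at [x] and [- x] bounds the absolute value. *)
Lemma norming_functional v : exists f : {linear X -> R^o},
  (forall x, `|f x| <= `|x|) /\ f v = `|v|.
Proof.
have [G [[Glin Gdom] Gv Gtot]] := dominated_graph_total v.
have Guniq x r s : G (x, r) -> G (x, s) -> r = s.
  have le a b : G (x, a) -> G (x, b) -> b <= a.
    move=> Ga Gb; have := Gdom _ (Glin (-1) _ _ Ga Gb).
    by rewrite scaleN1r/= addNr normr0 addrC subr_le0.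
  by move=> Gr Gs; apply/eqP; rewrite eq_le !le.
pose f x : R^o := sval (cid (Gtot x)).
have fP x : G (x, f x) := svalP (cid (Gtot x)).
have lf : linear f.
  by move=> c x y; apply: (Guniq (c *: x + y)) => //; exact: Glin (fP x) (fP y).
pose F : {linear X -> R^o} := HB.pack f (GRing.isLinear.Build _ _ _ _ f lf).
exists F; split => [x|]; last exact: Guniq (fP v) Gv.
rewrite ler_norml; apply/andP; split; last exact: Gdom (fP x).
by rewrite lerNl -(linearN F) -(normrN x); exact: Gdom (fP (- x)).
Qed.

End hahn_banach.

Lemma normr_linear_le_continuous (R : realType) (X : normedModType R)
    (f : {linear X -> R^o}) (M : R) :
  (forall x, `|f x| <= M * `|x|) -> continuous f.
Proof.
move=> fM; apply: bounded_linear_continuous; apply/linear_boundedP.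
exists M; split => [|r /ltW Mr x]; first exact: num_real.
by rewrite (le_trans (fM x))// ler_wpM2r.
Qed.

(** Letting [m] tend to infinity in the Cauchy estimate transfers the rate to the limit. *)
Lemma complete_cvg_dist_le (R : realType) (X : normedModType R)
    (u : nat -> X) (e : nat -> R) :
  complete_set [set: X] -> e @ \oo --> (0 : R) ->
  (forall n m, (n <= m)%N -> `|u m - u n| <= e n) ->
  exists2 l, u @ \oo --> l & forall n, `|l - u n| <= e n.
Proof.
move=> cX e0 ue.
have [|l _ ul] := cX (u @ \oo) _ filterT.
  apply/cauchy_exP => d d0.
  have [N _ eN] : \forall n \near \oo, e n < d by apply: cvgr_lt e0 _ _.
  exists (u N), N => // m Nm; rewrite /= -ball_normE/= distrC.
  by rewrite (le_lt_trans (ue _ _ Nm))// eN/=.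
exists l => // n.
have lu : `|u m - u n| @[m --> \oo] --> `|l - u n|.
  by apply: cvg_norm; apply: cvgB => //; exact: cvg_cst.
rewrite -(cvg_lim _ lu)//; apply: limr_le; first by apply/cvg_ex; exists `|l - u n|.
by exists n => // m /ue.
Qed.

Lemma complete_real (R : realType) : complete_set [set: R].
Proof. by apply/complete_setT => F FF; exact: cauchy_cvg. Qed.

(** * Weakly bounded sets are norm bounded *)

Section uniform_boundedness.
Context (R : realType) (X : normedModType R).

(* The signs make the correction [3^-m f_m] add up with, rather than cancel,
   what the previous functionals contribute at [v_m]. *)
Fixpoint hump (f : nat -> X -> R) (v : nat -> X) (n : nat) (x : X) : R :=
  if n is m.+1 then
    hump f v m x + (if 0 <= hump f v m (v m) then 1 else -1) * (3^-1) ^+ m * f m x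
  else 0.

(** If [V] is unbounded, pick [v n] in [V] of norm above [2 n 3^n] with norming functional [F n],
    and let [h] be the signed sum of the [3^-n F n]. The signs give [|g n.+1 (v n)| >= 3^-n |v n|],
    the tail removes at most half of this, and so [|h (v n)| >= n]. *)
Lemma weakly_bounded_bounded (V : set X) :
  (forall f : {linear X -> R^o}, continuous f ->
    exists M : R, forall v, V v -> `|f v| <= M) ->
  exists M : R, forall v, V v -> `|v| <= M.
Proof.
move=> wV; apply: contrapT => nbV.
have {}nbV (M : R) : exists v, V v /\ M < `|v|.
  apply: contrapT => nM; apply: nbV; exists M => v Vv.
  by rewrite leNgt; apply/negP => Mv; apply: nM; exists v.
pose v n := sval (cid (nbV (n%:R * 2 * 3 ^+ n))).
have vV n : V (v n) := (svalP (cid (nbV (n%:R * 2 * 3 ^+ n)))).1.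
have v_gt n : n%:R * 2 * 3 ^+ n < `|v n| := (svalP (cid (nbV (n%:R * 2 * 3 ^+ n)))).2.
pose F n := sval (cid (norming_functional (v n))).
have FP n : (forall x, `|F n x| <= `|x|) /\ F n (v n) = `|v n| :=
  svalP (cid (norming_functional (v n))).
pose g := hump F v.
have glin n : linear (g n : X -> R^o).
  elim: n => [|n IH] c x y; first by rewrite /g/= scaler0 addr0.
  rewrite /g/= -/g IH linearP mulrDr scalerDr -!addrA; congr (_ + _).
  by rewrite addrCA; congr (_ + (_ + _)); rewrite /GRing.scale/= mulrCA.
have t0 n : (0 : R) < 3^-1 ^+ n by rewrite exprn_gt0.
have gS n x : `|g n.+1 x - g n x| <= 3^-1 ^+ n * `|x|.
  rewrite /g/= -/g addrC addKr normrM normrM (gtr0_norm (t0 n)).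
  have -> : `|if 0 <= g n (v n) then 1 else -1 : R| = 1.
    by case: ifP; rewrite ?normrN normr1.
  by rewrite mul1r ler_wpM2l// ?(ltW (t0 n))//; exact: (FP n).1.
have gv n : 3^-1 ^+ n * `|v n| <= `|g n.+1 (v n)|.
  rewrite /g/= -/g (FP n).2.
  have h0 : 0 <= 3^-1 ^+ n * `|v n| by rewrite mulr_ge0// ltW.
  case: (leP 0 (g n (v n))) => gn; first by rewrite mul1r ger0_norm ?addr_ge0// lerDr.
  rewrite mulN1r mulNr -opprB normrN ger0_norm.
    by rewrite lerDl oppr_ge0 ltW.
  by rewrite addr_ge0// oppr_ge0 ltW.
(* The sum of [3^-m |x|] over [m >= n]. *)
pose e (x : X) n : R := 3 / 2 * 3^-1 ^+ n * `|x|.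
have e_cvg x : e x @ \oo --> (0 : R).
  rewrite -(mul0r `|x|); apply: cvgMl; rewrite -(mulr0 (3/2)).
  apply: cvgMr; apply: cvg_expr; rewrite ger0_norm//; lra.
have ge x n m : (n <= m)%N -> `|g m x - g n x| <= e x n.
  move=> nm.
  (* The difference of tails is a bound that an induction on [m] can carry. *)
  suff: `|g m x - g n x| <= e x n - e x m.
    by move=> /le_trans; apply; rewrite gerBl !mulr_ge0//; exact: ltW.
  elim: m nm => [|m IH]; first by rewrite leqn0 => /eqP ->; rewrite !subrr normr0.
  rewrite leq_eqVlt => /predU1P[->|/IH {}IH]; first by rewrite !subrr normr0.
  have -> : g m.+1 x - g n x = (g m.+1 x - g m x) + (g m x - g n x) by rewrite addrA subrK.
  rewrite (le_trans (ler_normD _ _))//.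
  rewrite (le_trans (lerD (gS m x) IH))// /e exprS; lra.
have /choice[h hP] : forall x, exists l : R,
    (g^~ x @ \oo --> l) /\ forall n, `|l - g n x| <= e x n.
  move=> x; have [l gl lg] := complete_cvg_dist_le (@complete_real R) (e_cvg x) (ge x).
  by exists l.
have hlin : linear (h : X -> R^o).
  move=> c x y.
  have : g^~ (c *: x + y) @ \oo --> (c * h x + h y : R).
    have -> : g^~ (c *: x + y) = (fun n => c * g n x + g n y).
      by apply/funext => n; exact: glin.
    by apply: cvgD; [apply: cvgMr|]; apply: (hP _).1.
  by apply: cvg_unique => //; exact: (hP _).1.
pose H : {linear X -> R^o} := HB.pack (h : X -> R^o)
  (GRing.isLinear.Build _ _ _ _ (h : X -> R^o) hlin).
have Hc : continuous H.
  apply: (@normr_linear_le_continuous _ _ _ (3 / 2)) => x.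
  by have := (hP x).2 0; rewrite /e expr0 mulr1 subr0.
have [M HM] := wV H Hc.
pose n := (Num.truncn M).+1.
have Mn : M < n%:R by exact: truncnS_gt.
have := HM _ (vV n); apply/negP; rewrite -ltNge (lt_le_trans Mn)//.
have gh : `|g n.+1 (v n)| <= `|h (v n)| + e (v n) n.+1.
  rewrite -{1}(subrK (h (v n)) (g n.+1 (v n))) addrC (le_trans (ler_normD _ _))//.
  by rewrite lerD2l distrC; exact: (hP _).2.
have nv : n%:R * 2 <= 3^-1 ^+ n * `|v n|.
  by rewrite exprVn [leRHS]mulrC ler_pdivlMr ?exprn_gt0// ltW.
have := le_trans (gv n) gh; rewrite /e exprS; set t := _ * `|v n| in nv *.
rewrite -!mulrA -/t => k; change (n%:R <= `|h (v n)|); lra.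
Qed.
End uniform_boundedness.

(** * Rearrangements and wuC series *)

Lemma cauchy_seq_lt (R : realType) (V : normedModType R) (s : nat -> V) (e : R) :
  cauchy (s @ \oo) -> 0 < e ->
  exists N, forall m n, (N <= m)%N -> (N <= n)%N -> `|s m - s n| < e.
Proof.
move=> /cauchyP sc e0; have [x [N _ sN]] := sc (e / 2) (divr_gt0 e0 (ltr0Sn R 1)).
exists N => m n Nm Nn; rewrite [ltRHS]splitr.
have := sN _ Nm; have := sN _ Nn; rewrite /= -!ball_normE/= => xn xm.
rewrite (le_lt_trans (ler_distD x _ _))// ltrD//.
by rewrite distrC.
Qed.

Section rearrangement.
Context (R : realType) (u : nat -> R).

Section concatenation.
Variables (b : nat -> nat) (P : pred nat).
Hypotheses (b0 : b 0%N = 0%N) (b_lt : forall j, (b j < b j.+1)%N).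

(* Each interval [b j, b j.+1) is permuted so that its elements satisfying [P]
   come first: some partial sum then isolates their contribution. *)
Fixpoint blocks (j : nat) : seq nat :=
  if j is i.+1 then
    blocks i ++ [seq x <- index_iota (b i) (b i.+1) | P x] ++
      [seq x <- index_iota (b i) (b i.+1) | ~~ P x]
  else [::].

(** For increasing [b] the default is never reached: [blocks n.+1] has length [b n.+1 > n], and
    later stages only append to it. *)
Definition block_rearr (n : nat) : nat := nth 0%N (blocks n.+1) n.

Lemma block_index_le j : (j <= b j)%N.
Proof. by elim: j => // j IH; rewrite (leq_ltn_trans IH). Qed.

Lemma perm_blocks j : perm_eq (blocks j) (index_iota 0 (b j)).
Proof.
elim: j => [|j IH]; first by rewrite b0.
have -> : index_iota 0 (b j.+1) = index_iota 0 (b j) ++ index_iota (b j) (b j.+1).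
  by rewrite /index_iota !subn0 -[in LHS](subnKC (ltnW (b_lt j))) iotaD add0n.
by rewrite perm_cat//; apply/permPl/perm_filterC.
Qed.

Lemma size_blocks j : size (blocks j) = b j.
Proof. by rewrite (perm_size (perm_blocks j)) size_iota subn0. Qed.

Lemma nth_blocks i j n : (n < b i)%N -> (i <= j)%N ->
  nth 0%N (blocks j) n = nth 0%N (blocks i) n.
Proof.
move=> ni /subnK <-; elim: (j - i)%N => // k IH.
rewrite addSn/= nth_cat size_blocks IH ifT// (leq_trans ni)//.
by elim: k {IH} => // k /leq_trans; apply; exact: ltnW.
Qed.

Lemma block_rearrE j n : (n < b j)%N -> block_rearr n = nth 0%N (blocks j) n.
Proof.
move=> nj; rewrite /block_rearr -(nth_blocks nj (leq_maxl j n.+1)).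
by rewrite (nth_blocks _ (leq_maxr j n.+1))// block_index_le.
Qed.

Lemma block_rearr_bij : bijective block_rearr.
Proof.
have inj : injective block_rearr.
  move=> m n; pose j := (maxn m n).+1.
  have mj : (m < b j)%N by rewrite (leq_trans _ (block_index_le j))// ltnS leq_maxl.
  have nj : (n < b j)%N by rewrite (leq_trans _ (block_index_le j))// ltnS leq_maxr.
  rewrite (block_rearrE mj) (block_rearrE nj) => /eqP.
  rewrite nth_uniq ?size_blocks//; first by move/eqP.
  by rewrite (perm_uniq (perm_blocks j)) iota_uniq.
have can : cancel (fun y => index y (blocks y.+1)) block_rearr.
  move=> y; have yb : y \in blocks y.+1.
    by rewrite (perm_mem (perm_blocks _)) mem_index_iota block_index_le.
  by rewrite (@block_rearrE y.+1) ?nth_index// -(size_blocks y.+1) index_mem.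
by exists (fun y => index y (blocks y.+1)) => //; exact: inj_can_sym can inj.
Qed.

Lemma series_block_rearr j : let A := [seq x <- index_iota (b j) (b j.+1) | P x] in
  series (u \o block_rearr) (b j + size A)%N - series (u \o block_rearr) (b j) =
  \sum_(b j <= i < b j.+1 | P i) u i.
Proof.
move=> A.
have seriesE r : (forall i, (i < size r)%N -> block_rearr i = nth 0%N r i) ->
    series (u \o block_rearr) (size r) = \sum_(x <- r) u x.
  move=> rE; rewrite /series/= [RHS](big_nth 0%N) big_nat [RHS]big_nat.
  by apply: eq_bigr => i /andP[_ ir]; rewrite rE.
have sizeA : size (blocks j ++ A) = (b j + size A)%N by rewrite size_cat size_blocks.
have sA := seriesE (blocks j ++ A); have sj := seriesE (blocks j).
rewrite sizeA in sA; rewrite size_blocks in sj.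
rewrite sA ?sj.
- by rewrite big_cat/= [X in X - _]addrC addrK big_filter.
- by move=> i; exact: block_rearrE.
move=> i iA; rewrite (@block_rearrE j.+1).
  by rewrite [blocks j.+1]/= catA nth_cat sizeA iA.
rewrite (leq_trans iA)// -(size_blocks j.+1) [blocks j.+1]/= catA size_cat sizeA.
exact: leq_addr.
Qed.

End concatenation.

(** Were the positive partial sums unbounded, cut points [b] could be chosen so that the positive
    terms of each block add up to at least 1. Listing them first in each block makes the rearranged
    partial sums jump by at least 1 infinitely often. *)
Lemma rearr_cauchy_pos_part_bounded :
  (forall pi : nat -> nat, bijective pi -> cauchy (series (u \o pi) @ \oo)) ->
  exists M : R, forall n, \sum_(0 <= i < n | 0 < u i) u i <= M.
Proof.
move=> uc; apply: contrapT => nM.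
have /choice[nxt nxtP] : forall N, exists M,
    (N < M)%N /\ 1 <= \sum_(N <= i < M | 0 < u i) u i.
  move=> N; apply: contrapT => nN; apply: nM.
  (* If no [M] worked for [N], the positive sum up to [N] plus 1 would bound all positive partial
     sums. *)
  exists (\sum_(0 <= i < N | 0 < u i) u i + 1) => n.
  have [nN'|Nn] := leqP n N.
    rewrite (big_cat_nat (leq0n n) nN')//= -addrA lerDl addr_ge0//.
    by rewrite sumr_ge0// => i /ltW.
  rewrite (big_cat_nat (leq0n N) (ltnW Nn))//= lerD2l leNgt; apply/negP => /ltW h.
  by apply: nN; exists n.
pose b := fix b j := if j is i.+1 then nxt (b i) else 0%N.
have b_lt j : (b j < b j.+1)%N by exact: (nxtP _).1.
have [N sN] := cauchy_seq_lt (uc _ (block_rearr_bij (fun i => 0 < u i) erefl b_lt)) ltr01.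
have Nb := block_index_le b_lt N.
pose A := [seq i <- index_iota (b N) (b N.+1) | 0 < u i].
have := sN _ _ (leq_trans Nb (leq_addr (size A) _)) Nb; rewrite ltNge => /negP; apply.
rewrite series_block_rearr// (le_trans _ (ler_norm _))//; exact: (nxtP _).2.
Qed.

End rearrangement.

Lemma rearr_cauchy_abs_bounded (R : realType) (u : nat -> R) :
  (forall pi : nat -> nat, bijective pi -> cauchy (series (u \o pi) @ \oo)) ->
  exists M : R, forall n, \sum_(0 <= i < n) `|u i| <= M.
Proof.
move=> uc; have [M hM] := rearr_cauchy_pos_part_bounded uc.
have [|N hN] := @rearr_cauchy_pos_part_bounded _ (fun i => - u i).
  move=> pi bpi; apply/cauchyP => e e0.
  have /cauchyP/(_ e e0)[x [K _ xs]] := uc pi bpi; exists (- x).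
  exists K => // n /xs; rewrite -!ball_normE/=.
  by rewrite /series/= sumrN -opprD normrN.
exists (M + N) => n; rewrite (le_trans _ (lerD (hM n) (hN n)))//.
rewrite [in leRHS]big_mkcond [X in _ <= _ + X]big_mkcond -big_split/= ler_sum// => i _.
rewrite oppr_gt0; case: (ltgtP (u i) 0) => [u0|u0|->]; last by rewrite normr0 addr0.
- by rewrite add0r ltr0_norm.
- by rewrite addr0 gtr0_norm.
Qed.

(** * Norm bounds for the partial sums of wuC series *)

Section wuC_bound.
Context (R : realType) (X : normedModType R) (x : nat -> X).

Lemma wuC_functional_bounded (f : {linear X -> R^o}) : wuC x -> continuous f ->
  exists M : R, forall n, \sum_(0 <= i < n) `|f (x i)| <= M.
Proof.
move=> wx fc; apply: (@rearr_cauchy_abs_bounded R (f \o x)) => pi bpi.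
suff -> : series ((f \o x) \o pi) = f \o series (x \o pi) by exact: wx.
by apply/funext => n; rewrite /= /series/= linear_sum.
Qed.

(** The partial sums with coefficients of modulus at most 1 form a weakly bounded set, because [f]
    maps them below [\sum |f (x i)|]. Hence they are norm bounded, and scaling by [M] gives the
    general case. *)
Lemma wuC_norm_series_le : wuC x -> exists2 H : R, 0 < H &
  forall (a : nat -> R) M, (forall i, `|a i| <= M) ->
    forall n, `|series (fun i => a i *: x i) n| <= H * M.
Proof.
move=> wx.
pose V := [set v | exists a : nat -> R, exists2 n, (forall i, `|a i| <= 1) &
  v = series (fun i => a i *: x i) n].
have [f fc|H HV] := @weakly_bounded_bounded _ _ V.
  have [M fM] := wuC_functional_bounded wx fc; exists M => _ [a [n a1 ->]].
  rewrite /series/= linear_sum (le_trans (ler_norm_sum _ _ _))// (le_trans _ (fM n))//.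
  by rewrite ler_sum// => i _; rewrite linearZ normrM ler_piMl.
exists (`|H| + 1) => [|a M aM n]; first by rewrite ltr_pwDr.
have M0 : 0 <= M by rewrite (le_trans _ (aM 0%N)).
have [M_eq0|Mn0] := eqVneq M 0.
  rewrite M_eq0 mulr0 /series/= big1 ?normr0// => i _.
  by have := aM i; rewrite M_eq0 normr_le0 => /eqP ->; rewrite scale0r.
have {Mn0 M0} M0 : 0 < M by rewrite lt_def Mn0.
rewrite -ler_pdivrMr// mulrC -[X in X * _]gtr0_norm ?invr_gt0// -normrZ.
rewrite (@le_trans _ _ H)//; last by rewrite (le_trans (ler_norm H))// lerDl.
apply: HV; exists (fun i => M^-1 * a i), n => [i|].
  by rewrite normrM gtr0_norm ?invr_gt0// ler_pdivrMl// mulr1.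
by rewrite /series/= scaler_sumr; apply: eq_bigr => i _; rewrite scalerA.
Qed.

End wuC_bound.

(** * Convergence in density *)

(** Clears the denominator; where [n r = 0], the inverse is 0 by convention and [S r = 0] makes the
    inequality trivial. *)
Lemma ratio_cvg0P (R : realType) (S : nat -> R) (n : nat -> nat) :
  (forall r, 0 <= S r) -> (forall r, n r = 0%N -> S r = 0) ->
  ((n r)%:R^-1 * S r @[r --> \oo] --> (0 : R) <->
   forall d : R, 0 < d -> \forall r \near \oo, S r <= d * (n r)%:R).
Proof.
move=> S0 Sn0; split=> [Sn d d0|SP].
  have [N _ SN] : \forall r \near \oo, (n r)%:R^-1 * S r < d by apply: cvgr_lt Sn _ _.
  exists N => // r /SN /ltW /=.
  have [/[dup] n0 /Sn0 -> _|n0] := posnP (n r); first by rewrite n0 mulr0.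
  by rewrite ler_pdivrMl ?ltr0n// mulrC.
apply/cvgr0Pnorm_le => d d0; have [N _ SN] := SP d d0.
exists N => // r /SN /= Sd; rewrite ger0_norm ?mulr_ge0//.
have [/[dup] n0 /Sn0 -> |n0] := posnP (n r); first by rewrite mulr0 ltW.
by rewrite ler_pdivrMl ?ltr0n// mulrC.
Qed.

Section density_convergence.
Context (R : realType) (X : normedModType R) (J : nat -> seq nat).
Implicit Types (s t : nat -> X) (L M : X).

(** A common form over index sets [J r]: the lacunary intervals give S_theta-convergence, the sets
    [{1, ..., n}] ordinary statistical convergence. Likewise [strong_cvg] covers N_theta (with
    [p = 1]) and w_p. *)
Definition density_cvg s L : Prop := forall e : R, 0 < e ->
  (size (J r))%:R^-1 * (count (fun k => e <= `|s k - L|) (J r))%:R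
    @[r --> \oo] --> (0 : R).

Definition strong_cvg (p : R) s L : Prop :=
  (size (J r))%:R^-1 * (\sum_(k <- J r) `|s k - L| `^ p) @[r --> \oo] --> (0 : R).

Lemma density_cvgP s L : density_cvg s L <->
  forall e d : R, 0 < e -> 0 < d -> \forall r \near \oo,
    (count (fun k => e <= `|s k - L|) (J r))%:R <= d * (size (J r))%:R.
Proof.
have P e := @ratio_cvg0P R
  (fun r => (count (fun k => e <= `|s k - L|) (J r))%:R) (fun r => size (J r)).
split=> [sL e d e0 d0|sL e e0].
  by apply: (P e _ _).1 d d0; [move=> r|move=> r /size0nil ->|exact: sL].
by apply: (P e _ _).2; [move=> r|move=> r /size0nil ->|move=> d; exact: sL].
Qed.

(** Forward, Markov's inequality. Backward, the few indices with [|s k - L| >= e] contribute a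
    bounded amount each, and all others at most [e^p]. *)
Lemma bounded_strong_cvgP (p K : R) s L : 1 <= p -> (forall k, `|s k| <= K) ->
  strong_cvg p s L <-> density_cvg s L.
Proof.
move=> p1 sK; have p0 : 0 < p by rewrite (lt_le_trans ltr01).
have P := @ratio_cvg0P R
  (fun r => \sum_(k <- J r) `|s k - L| `^ p) (fun r => size (J r)).
have {}P := P (fun r => sumr_ge0 _ (fun k _ => powR_ge0 _ _)).
have {}P : strong_cvg p s L <-> _ := P _.
rewrite {}P => [|r /size0nil ->]; last by rewrite big_nil.
rewrite density_cvgP; split=> [sL e d e0 d0|sL d d0].
  have ep : 0 < e `^ p by rewrite powR_gt0.
  have [N _ sN] := sL (e `^ p * d) (mulr_gt0 ep d0).
  exists N => // r /sN /=; rewrite -mulrA => h.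
  rewrite -(ler_pM2l ep); apply: le_trans h.
  rewrite -sum1_count natr_sum mulr_sumr big_mkcond/= ler_sum// => k _.
  by case: ifPn => [ek|_]; rewrite ?mulr1 ?powR_ge0// ge0_ler_powR ?nnegrE// ltW.
(* [C] bounds every term, the added 1 making it positive; [e] is chosen so that [e^p = d / 2]. *)
pose C : R := (K + `|L|) `^ p + 1.
have C0 : 0 < C by rewrite ltr_wpDl ?powR_ge0.
have K0 : 0 <= K by exact: le_trans (normr_ge0 _) (sK 0%N).
pose e : R := (d / 2) `^ p^-1.
have d20 : 0 < d / 2 by lra.
have [N _ sN] := sL e (d / 2 / C) (powR_gt0 _ d20) (divr_gt0 d20 C0).
exists N => // r /sN /= h.
have {}h : C * (count (fun k => e <= `|s k - L|) (J r))%:R <= d / 2 * (size (J r))%:R.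
  by rewrite mulrC -ler_pdivlMr// mulrAC.
rewrite [leRHS](_ : _ = d / 2 * (size (J r))%:R + d / 2 * (size (J r))%:R); last lra.
rewrite (le_trans _ (lerD h (lexx _)))//.
rewrite -sum1_count -[X in d / 2 * X%:R]sum1_size !natr_sum !mulr_sumr.
rewrite [X in _ <= X + _]big_mkcond/= -big_split/=.
rewrite ler_sum// => k _; case: ifPn => [_|].
  rewrite mulr1 (@le_trans _ _ ((K + `|L|) `^ p))//.
    rewrite ge0_ler_powR ?nnegrE ?addr_ge0// ?(ltW p0)//.
    by rewrite (le_trans (ler_normB _ _))// lerD2r.
  by rewrite mulr1 /C -addrA lerDl addr_ge0// ltW.
rewrite -ltNge add0r mulr1 => /ltW ke.
rewrite (@le_trans _ _ (e `^ p))//; first by rewrite ge0_ler_powR ?nnegrE ?powR_ge0// ltW.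
by rewrite /e -powRrM mulVf ?gt_eqF// powRr1// ltW.
Qed.

Hypothesis J_size : size (J r) @[r --> \oo] --> \oo.
Hypothesis J_uniq : forall r, uniq (J r).

(** Without repetitions, [J r] has at most [K] exceptional indices, a vanishing proportion as its
    size grows. *)
Lemma density_cvg_eventually_cst s L K :
  (forall k, (K <= k)%N -> s k = L) -> density_cvg s L.
Proof.
move=> sL; apply/density_cvgP => e d e0 d0.
have [N _ JN] : \forall r \near \oo, ((Num.truncn (K%:R / d)).+1 <= size (J r))%N.
  by have := J_size (nbhs_infty_ge (Num.truncn (K%:R / d)).+1).
exists N => // r /JN /= Jr.
rewrite (@le_trans _ _ K%:R)//.
  rewrite ler_nat -size_filter -[leqRHS](size_iota 0) uniq_leq_size ?filter_uniq//.
  move=> k; rewrite mem_filter mem_iota => /andP[ek _]; rewrite ltnNge; apply/negP => Kk.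
  by move: ek; rewrite sL// subrr normr0 leNgt e0.
rewrite mulrC -ler_pdivrMr// ltW// (lt_le_trans (truncnS_gt _))//.
by rewrite ler_nat.
Qed.

(** For large [r] each of the two exceptional sets fills at most a third of the nonempty [J r], so
    some index avoids both; the limits are compared there. *)
Lemma density_cvg_dist s t L M (c : R) : density_cvg s L -> density_cvg t M ->
  (forall k, `|s k - t k| <= c) -> `|L - M| <= c.
Proof.
move=> /density_cvgP sL /density_cvgP tM st; apply/ler_addgt0Pr => e e0.
have e20 : 0 < e / 2 by lra.
have d0 : (0 : R) < 3^-1 by lra.
have J1 : \forall r \near \oo, (1 <= size (J r))%N := J_size (nbhs_infty_ge 1%N).
have [r [/= [hs ht] hJ]] := filter_ex
  (filterI (filterI (sL _ _ e20 d0) (tM _ _ e20 d0)) J1).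
have /hasP[k _ /norP[]] : has
    (predC (predU (fun k => e / 2 <= `|s k - L|) (fun k => e / 2 <= `|t k - M|))) (J r).
  rewrite has_predC all_count; apply/negP => /eqP Jr.
  have : (size (J r) <= count (fun k => e / 2 <= `|s k - L|)%R (J r) +
      count (fun k => e / 2 <= `|t k - M|)%R (J r))%N.
    by rewrite -[leqLHS]Jr -count_predUI leq_addr.
  rewrite -(ler_nat R) natrD => h.
  have : 1 <= (size (J r))%:R :> R by rewrite ler1n.
  lra.
rewrite -!ltNge => sk tk.
have -> : L - M = (s k - t k) - (s k - L) + (t k - M).
  by rewrite opprB [s k - t k + _]addrC [_ + (s k - t k)]addrA subrK addrA subrK.
rewrite (le_trans (ler_normD _ _))// (le_trans (lerD (ler_normB _ _) (lexx _)))//.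
have := st k; lra.
Qed.

(** With an approximant at precision [e / 3], [|s k - L| >= e] forces [|t k - M| >= e / 3]. *)
Lemma density_cvg_approx s L :
  (forall e : R, 0 < e -> exists t M,
    [/\ density_cvg t M, forall k, `|s k - t k| <= e & `|L - M| <= e]) ->
  density_cvg s L.
Proof.
move=> sL; apply/density_cvgP => e d e0 d0.
have e30 : 0 < e / 3 by lra.
have [t [M [/density_cvgP/(_ _ _ e30 d0)[N _ tN] st LM]]] := sL _ e30.
exists N => // r /tN /=; apply: le_trans; rewrite ler_nat; apply: sub_count => k /=.
have -> : s k - L = (s k - t k) + (t k - M) - (L - M).
  by rewrite addrA subrK opprB addrA subrK.
move=> /le_trans /(_ (ler_normB _ _)) h.
by have := st k; have := ler_normD (s k - t k) (t k - M); lra.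
Qed.

End density_convergence.

(** * Completeness *)

Lemma geometric_cvg0 (R : realType) (c q : R) : 0 <= q < 1 ->
  c * q ^+ n @[n --> \oo] --> (0 : R).
Proof.
move=> /andP[q0 q1]; rewrite -(mulr0 c); apply: cvgMr.
by apply: cvg_expr; rewrite ger0_norm.
Qed.

(** Reduces Cauchy filters to fast Cauchy sequences: balls of radius [c / 2 * q^n] belonging to the
    filter meet pairwise, which bounds the distances of their centres. *)
Lemma complete_set_geometric (R : realType) (V : normedModType R) (A : set V) (c q : R) :
  0 < c -> 0 < q < 1 ->
  (forall u : nat -> V, (forall n, A (u n)) ->
    (forall n m, (n <= m)%N -> `|u m - u n| <= c * q ^+ n) ->
    exists2 l, A l & forall n, `|l - u n| <= c * q ^+ n) ->
  complete_set A.
Proof.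
move=> c0 /andP[q0 q1] hA F FF FA /cauchyP Fc.
have cq0 n : 0 < c / 2 * q ^+ n by rewrite mulr_gt0 ?exprn_gt0// divr_gt0.
have /choice[u uP] : forall n, exists y, A y /\ F (ball y (c / 2 * q ^+ n)).
  (* The centre [x] may lie outside [A]; halving the radius allows replacing it by a point of
     [A]. *)
  move=> n; have [x Fx] := Fc (c / 2 * q ^+ n / 2) (divr_gt0 (cq0 n) (ltr0Sn R 1)).
  have [y [Ay xy]] := filter_ex (filterI FA Fx); exists y; split => //.
  apply: filterS Fx => z xz; rewrite [_ * _]splitr.
  exact: ball_triangle (ball_sym xy) xz.
have [||l Al lu] := hA u.
- by move=> n; exact: (uP n).1.
- move=> n m nm; have [y []] := filter_ex (filterI (uP n).2 (uP m).2).
  rewrite -!ball_normE/= => ny my.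
  rewrite (le_trans (ler_distD y _ _))//.
  have qmn : q ^+ m <= q ^+ n by rewrite ler_wiXn2l ?ltW.
  have : c / 2 * q ^+ m <= c / 2 * q ^+ n by rewrite ler_pM2l// divr_gt0.
  by rewrite (distrC y); lra.
exists l => //; apply/cvgrPdist_lt => e e0.
have q01 : 0 <= q < 1 by rewrite ltW.
have [N _ Ne] : \forall n \near \oo, c * q ^+ n < e / 2.
  by apply: cvgr_lt (geometric_cvg0 c q01) _ _; rewrite divr_gt0.
have /= {}Ne := Ne N (leqnn N).
apply: filterS (uP N).2 => y; rewrite -ball_normE/= => uy.
rewrite (le_lt_trans (ler_distD (u N) _ _))//.
by have := lu N; have := cq0 N; lra.
Qed.

Section linf_limits.
Context (R : realType).

Lemma linf_cvg_dist_le (a : nat -> linf R) (e : nat -> R) : e @ \oo --> (0 : R) ->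
  (forall n m, (n <= m)%N -> `|a m - a n| <= e n) ->
  exists b, forall n, `|b - a n| <= e n.
Proof.
move=> e0 ae.
have /choice[b bP] i : exists l : R, forall n, `|l - a n i| <= e n.
  have [n m nm|l _ lP] := @complete_cvg_dist_le _ _ (fun n => a n i : R) e (@complete_real R) e0.
    exact: le_trans (le_linf_norm (a m - a n) i) (ae _ _ nm).
  by exists l.
have bB : b \in @linf_pred R.
  apply/mem_set/bounded_seqP; exists (e 0%N + `|a 0%N|) => i.
  rewrite -[b i](subrK (a 0%N i)) (le_trans (ler_normD _ _))// lerD//.
  exact: (le_linf_norm (a 0%N) i).
by exists (Linf bB) => n; apply: linf_norm_le => i; exact: bP.
Qed.

End linf_limits.

Section absolutely_summable_series.
Context (R : realType).

Lemma sum_half_expr_le (n : nat) : \sum_(0 <= i < n) 2^-1 ^+ i <= 2 :> R.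
Proof.
suff -> : \sum_(0 <= i < n) 2^-1 ^+ i = 2 - 2 * 2^-1 ^+ n :> R.
  by rewrite gerBl mulr_ge0// exprn_ge0.
elim: n => [|n IH]; first by rewrite big_geq// expr0; lra.
by rewrite big_nat_recr//= IH exprS; lra.
Qed.

Lemma sum_half_expr_uniq_le (s : seq nat) : uniq s -> \sum_(i <- s) 2^-1 ^+ i <= 2 :> R.
Proof.
move=> us; pose K := (\max_(i <- s) i).+1.
have sK i : i \in s -> (i < K)%N by move=> si; rewrite ltnS leq_bigmax_seq.
have -> : \sum_(i <- s) 2^-1 ^+ i = \sum_(0 <= i < K | i \in s) 2^-1 ^+ i :> R.
  rewrite -[RHS]big_filter; apply: perm_big; apply: uniq_perm => //.
    by rewrite filter_uniq// iota_uniq.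
  by move=> i; rewrite mem_filter mem_index_iota/= andb_idr// => /sK.
rewrite (le_trans _ (sum_half_expr_le K))// [leLHS]big_mkcond ler_sum// => i _.
by case: ifP => // _; rewrite exprn_ge0.
Qed.

(** A permutation only selects distinct powers of 1/2, so the absolute sums under a bounded
    functional stay below [r * C * 2]. *)
Lemma geometric_wuC (X : normedModType R) (x : nat -> X) (C : R) :
  (forall i, `|x i| <= C * 2^-1 ^+ i) -> wuC x.
Proof.
move=> xC pi bpi f fc.
have C0 : 0 <= C by have := xC 0%N; rewrite expr0 mulr1; exact: le_trans.
have [r [r0 fr]] : exists r : R, 0 < r /\ forall y, `|f y| <= r * `|y|.
  have /linear_boundedP := (linear_bounded_continuous f).2 fc.
  by move=> /pinfty_ex_gt0[r r0 fr]; exists r.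
have -> : f \o series (x \o pi) = series (f \o x \o pi).
  by apply/funext => n; rewrite /= /series/= linear_sum.
apply: cvg_cauchy; apply: normed_cvg; apply: nondecreasing_is_cvgn.
  by apply: nondecreasing_series => i _ _; exact: normr_ge0.
exists (r * C * 2) => _ [n _ <-]; rewrite /series/=.
rewrite (@le_trans _ _ (r * C * \sum_(i <- [seq pi i | i <- index_iota 0 n]) 2^-1 ^+ i))//.
  rewrite big_map mulr_sumr ler_sum// => i _.
  by rewrite (le_trans (fr _))// -mulrA ler_wpM2l// ltW.
rewrite ler_wpM2l ?mulr_ge0// ?(ltW r0)// sum_half_expr_uniq_le//.
by rewrite map_inj_uniq ?iota_uniq//; exact: bij_inj.
Qed.

End absolutely_summable_series.

(** * Completeness of X and of the density summability spaces *)

Section completeness_criterion.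
Context (R : realType) (X : normedModType R) (J : nat -> seq nat).
Hypothesis J_size : size (J r) @[r --> \oo] --> \oo.
Hypothesis J_uniq : forall r, uniq (J r).

Lemma complete_S_set_density (x : nat -> X) :
  complete_set [set: X] -> wuC x -> complete_set (S_set (density_cvg J) x).
Proof.
move=> cX wx; have [H H0 xH] := wuC_norm_series_le wx.
have half01 : 0 < (2^-1 : R) < 1 by apply/andP; split; lra.
have half01' : 0 <= (2^-1 : R) < 1 by apply/andP; split; lra.
apply: (complete_set_geometric ltr01 half01) => a aS ae.
(* The sup-norm limit [b] exists in any case; what remains is its membership in the summability
   set. *)
have [b ba] := linf_cvg_dist_le (geometric_cvg0 1 half01') ae.
have abs_le (c d : linf R) (M : R) k : `|c - d| <= M ->
    `|series (fun i => c i *: x i) k - series (fun i => d i *: x i) k| <= H * M.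
  move=> cdM; rewrite /series/= -sumrB.
  under eq_bigr do rewrite -scalerBl.
  apply: (xH (fun i => c i - d i)) => i.
  exact: le_trans (le_linf_norm (c - d) i) cdM.
have /choice[L LP] := aS.
have He0 : H * (1 * 2^-1 ^+ n) @[n --> \oo] --> (0 : R).
  by rewrite -(mulr0 H); apply: cvgMr; exact: geometric_cvg0.
have [n m nm|l _ lL] := complete_cvg_dist_le cX He0 (u := L).
  by apply: (density_cvg_dist J_size (LP m) (LP n)) => k; exact: abs_le (ae _ _ nm).
exists b => //; exists l; apply: density_cvg_approx => e e0.
have [N _ HN] : \forall n \near \oo, H * (1 * 2^-1 ^+ n) < e by apply: cvgr_lt He0 _ _.
have /= /ltW {}HN := HN N (leqnn N).
exists (series (fun i => a N i *: x i)), (L N); split => //.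
- by move=> k; apply: le_trans HN; exact: abs_le.
- exact: le_trans (lL N) HN.
Qed.

Lemma density_complete :
  (forall x : nat -> X, wuC x -> complete_set (S_set (density_cvg J) x)) ->
  complete_set [set: X].
Proof.
move=> cS; have quarter01 : 0 < (4^-1 : R) < 1 by apply/andP; split; lra.
apply: (complete_set_geometric ltr01 quarter01) => u _ ue1.
have ue n m : (n <= m)%N -> `|u m - u n| <= 4^-1 ^+ n by move=> /ue1; rewrite mul1r.
(* The rate [4^-i] leaves room for the factor [2^i]: the terms still decay like [2^-i], and the
   bounded coefficients [2^-i] restore the increments of [u]. *)
pose x i := (2 : R) ^+ i *: (u i.+1 - u i).
have wx : wuC x.
  apply: (@geometric_wuC _ _ _ 1) => i; rewrite mul1r normrZ ger0_norm ?exprn_ge0//.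
  have := ue i i.+1 (leqnSn i); rewrite -(ler_pM2l (exprn_gt0 i (ltr0Sn R 1))).
  by rewrite -exprMn (_ : 2 * 4^-1 = 2^-1 :> R)//; lra.
have h0 i : 0 <= 2^-1 ^+ i :> R by rewrite exprn_ge0.
have h1 i : 2^-1 ^+ i <= 1 :> R by rewrite exprn_ile1//; lra.
have aB : (fun i => 2^-1 ^+ i) \in @linf_pred R.
  by apply/mem_set/bounded_seqP; exists 1 => i; rewrite ger0_norm.
have bB n : (fun i => if (i < n)%N then 2^-1 ^+ i else 0) \in @linf_pred R.
  apply/mem_set/bounded_seqP; exists 1 => i.
  by case: ifP => _; rewrite ?normr0 ?ger0_norm.
pose a := Linf aB; pose b n := Linf (bB n).
have ba : b @ \oo --> a.
  apply/cvgrPdist_le => e e0.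
  have half01 : 0 <= (2^-1 : R) < 1 by apply/andP; split; lra.
  have [N _ Ne] : \forall n \near \oo, 1 * 2^-1 ^+ n < e.
    exact: (cvgr_lt _ (geometric_cvg0 1 half01) _ e0).
  exists N => // n /Ne /ltW; rewrite /= mul1r => ne.
  apply: (@le_trans _ R _ _ _ _ ne); apply: linf_norm_le => i.
  rewrite -[(a - b n) i]/(2^-1 ^+ i - (if (i < n)%N then 2^-1 ^+ i else 0)).
  case: ltnP => [_|ni]; first by rewrite subrr normr0; exact: h0.
  by rewrite subr0 ger0_norm// ler_wiXn2l//; lra.
have termE i : 2^-1 ^+ i *: x i = u i.+1 - u i.
  by rewrite /x scalerA -exprMn mulVf// expr1n scale1r.
have series_a : series (fun i => a i *: x i) = (fun k => u k - u 0%N).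
  apply/funext => k; rewrite /series/=; under eq_bigr do rewrite termE.
  by rewrite telescope_sumr.
(* Truncating the coefficients at [n] freezes the partial sums from [n] on, which places [b n] in
   the summability set. *)
have series_b n k : (n <= k)%N -> series (fun i => b n i *: x i) k = u n - u 0%N.
  move=> nk; rewrite /series/= (big_cat_nat (leq0n n) nk)/=.
  rewrite [X in _ + X]big_nat [X in _ + X]big1 => [|i /andP[ni _]]; last first.
    by rewrite ltnNge ni scale0r.
  rewrite addr0 -(telescope_sumr u (leq0n n)) [LHS]big_nat [RHS]big_nat.
  by apply: eq_bigr => i /andP[_ ->]; rewrite termE.
have bS n : S_set (density_cvg J) x (b n).
  by exists (u n - u 0%N); apply: density_cvg_eventually_cst (series_b n).
have [||c [L cL] bc] := cS x wx (b @ \oo).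
- by exists 0%N => // n _; exact: bS.
- by apply: cvg_cauchy; apply/cvg_ex; exists a.
have ac : c = a by apply: (cvg_unique _ bc ba); exact: norm_hausdorff.
rewrite {}ac series_a in cL.
exists (L + u 0%N) => // n; rewrite mul1r.
(* The sequence [u - u 0] stopped at [n]: it stays within [4^-n] of [u - u 0], so the density limits
   are equally close. *)
pose t k := if (k < n)%N then u k - u 0%N else u n - u 0%N.
have tL : density_cvg J t (u n - u 0%N).
  by apply: (@density_cvg_eventually_cst _ _ _ _ _ _ _ n) => // k nk; rewrite /t ltnNge nk.
have -> : L + u 0%N - u n = L - (u n - u 0%N) by rewrite opprB addrA.
apply: (density_cvg_dist J_size cL tL) => k; rewrite /t; case: ltnP => [_|nk].
  by rewrite subrr normr0 exprn_ge0.
by rewrite opprB addrA subrK; exact: ue.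
Qed.

(** Agreement on bounded sequences suffices, since a wuC series with bounded coefficients has
    bounded partial sums. *)
Lemma complete_iff_S_set (C : (nat -> X) -> X -> Prop) :
  (forall (s : nat -> X) (K : R) L, (forall k, `|s k| <= K) -> C s L <-> density_cvg J s L) ->
  complete_set [set: X] <->
    (forall x : nat -> X, wuC x -> complete_set (S_set C x)).
Proof.
move=> CJ; have SE (x : nat -> X) : wuC x -> S_set C x = S_set (density_cvg J) x.
  move=> wx; have [H _ xH] := wuC_norm_series_le wx.
  apply/seteqP; split => a [L aL]; exists L; move: aL;
    by apply (CJ _ _ _ (xH a _ (fun i => le_linf_norm a i))).
split=> [cX x wx|cS]; first by rewrite SE//; exact: complete_S_set_density.
by apply: density_complete => x wx; rewrite -SE//; exact: cS.
Qed.

End completeness_criterion.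

(** * The criterion for lacunary intervals and initial segments *)

Theorem corollary5p3 (R : realType) (X : normedModType R) (p : R)
    (theta : nat -> nat) (p_ge1 : 1 <= p) (theta_lac : lacunary theta) :
  [<-> complete_set [set: X];
       forall x : nat -> X, wuC x -> complete_set (S_Ntheta theta x);
       forall x : nat -> X, wuC x -> complete_set (S_Stheta theta x);
       forall x : nat -> X, wuC x -> complete_set (S_wp p x)].
Proof.
have [_ _ h_oo] := theta_lac.
have size_lac r : size (lac_I theta r) = lac_h theta r by rewrite size_iota subSS.
have lac_size : size (lac_I theta r) @[r --> \oo] --> \oo.
  by rewrite (_ : (fun r => _) = lac_h theta)//; exact/funext.
have lac_uniq r : uniq (lac_I theta r) by exact: iota_uniq.
have size_ces n : size (index_iota 1 n.+1) = n by rewrite size_iota subSS subn0.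
have ces_size : size (index_iota 1 n.+1) @[n --> \oo] --> \oo.
  by rewrite (_ : (fun n => _) = id); [exact: cvg_id|exact/funext].
have ces_uniq n : uniq (index_iota 1 n.+1) by exact: iota_uniq.
have N12 : complete_set [set: X] <->
    forall x : nat -> X, wuC x -> complete_set (S_Ntheta theta x).
  apply: (complete_iff_S_set lac_size lac_uniq) => s K L sK.
  (* N_theta-summability is strong convergence with exponent 1. *)
  rewrite -(bounded_strong_cvgP _ _ (lexx 1) sK) /strong_cvg /Ntheta_cvg.
  suff -> : (fun r => (size (lac_I theta r))%:R^-1 *
      \sum_(k <- lac_I theta r) `|s k - L| `^ 1) =
    (fun r => (lac_h theta r)%:R^-1 * \sum_(k <- lac_I theta r) `|s k - L|) by [].
  by apply/funext => r; rewrite size_lac; under eq_bigr do rewrite powRr1//.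
have N13 : complete_set [set: X] <->
    forall x : nat -> X, wuC x -> complete_set (S_Stheta theta x).
  apply: (complete_iff_S_set lac_size lac_uniq) => s K L sK.
  rewrite /density_cvg /Stheta_cvg.
  suff ratioE e : (fun r => (size (lac_I theta r))%:R^-1 *
      (count (fun k => e <= `|s k - L|) (lac_I theta r))%:R) =
    (fun r => (lac_h theta r)%:R^-1 *
      (count (fun k => e <= `|s k - L|) (lac_I theta r))%:R : R).
    by split=> sL e /sL; rewrite ratioE.
  by apply/funext => r; rewrite size_lac.
have N14 : complete_set [set: X] <->
    forall x : nat -> X, wuC x -> complete_set (S_wp p x).
  apply: (complete_iff_S_set ces_size ces_uniq) => s K L sK.
  rewrite -(bounded_strong_cvgP _ _ p_ge1 sK) /strong_cvg /wp_cvg.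
  suff -> : (fun n => (size (index_iota 1 n.+1))%:R^-1 *
      \sum_(k <- index_iota 1 n.+1) `|s k - L| `^ p) =
    (fun n => n%:R^-1 * \sum_(1 <= k < n.+1) `|s k - L| `^ p) by [].
  by apply/funext => n; rewrite size_ces.
(* Each step of the cycle passes through completeness of [X]. *)
tfae.
- by move/N12.
- by move/N12/N13.
- by move/N13/N14.
- by move/N14.
Qed.
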